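(* There are no globally periodic cases in the family of Gumovski--Mira recurrences $$x_{n+2}=-x_n+\frac{x_{n+1}}{b+x_{n+1}^2},\qquad b\in\mathbb{C}.$$
   Context: A recurrence is globally $p$-periodic if for all (complex) initial conditions for which the sequence $\{x_n\}$ is well defined, the sequence is $p$-periodic ($x_{n+p}=x_n$ for all $n$), and $p$ is the smallest positive integer with this property. It is globally periodic if it is globally $p$-periodic for some $p$. *)

(* Defs.v *)
From mathcomp Require Import all_boot all_order all_algebra.
From mathcomp Require Import complex.
From mathcomp Require Import reals.

Set Implicit Arguments.
Unset Strict Implicit.
Unset Printing Implicit Defensive.

Import Order.TTheory GRing.Theory Num.Theory.
Local Open Scope ring_scope.

(* A second-order recurrence x_{n+2} = f (x_n, x_{n+1}) is given by a partial
   map [f]; [None] marks the points where the right-hand side is undefined.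
   A solution is an infinite sequence along which [f] is always defined; it is
   determined by x_0 and x_1, so quantifying over solutions amounts to
   quantifying over the initial conditions for which {x_n} is well defined. *)
Definition solution (T : Type) (f : T -> T -> option T) (x : nat -> T) : Prop :=
  forall n : nat, f (x n) (x n.+1) = Some (x n.+2).

Definition periodic_seq (T : Type) (p : nat) (x : nat -> T) : Prop :=
  forall n : nat, x (n + p)%N = x n.

Definition all_periodic (T : Type) (f : T -> T -> option T) (p : nat) : Prop :=
  forall x : nat -> T, solution f x -> periodic_seq p x.

Definition globally_p_periodic (T : Type) (f : T -> T -> option T) (p : nat) :
  Prop :=
  [/\ (0 < p)%N,
      all_periodic f p
    & forall q : nat, (0 < q)%N -> all_periodic f q -> (p <= q)%N].

Definition globally_periodic (T : Type) (f : T -> T -> option T) : Prop :=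
  exists p : nat, globally_p_periodic f p.

Definition gumovski_mira (R : realType) (b x y : R[i]) : option R[i] :=
  if b + y ^+ 2 == 0 then None else Some (- x + y / (b + y ^+ 2)).

(* Main.v *)
(** If x_{n+2} = f (x_n, x_{n+1}) is globally periodic, so is its linearization
    along any solution. Along the constant solution x with x^2 = 1/2 - b and
    along the alternating solution x, -x, x, ... with x^2 = -1/2 - b, the
    linearization is d_{n+2} = t d_{n+1} - d_n with t = 8b - 2 and t = 8b + 2
    respectively. Periodicity forces t = l + 1/l for a root of unity l, hence
    t is real and -2 <= t <= 2; both bounds together give b = 0. For b = 0 the
    solution 1, -1, -2, 1/2, 4, ... is unbounded.

    A perturbed initial condition need not have a well-defined orbit. On a line
    of initial conditions with parameter s, however, x_n is a rational function
    of s, regular at s = 0, so all but countably many s are admissible;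
    periodicity at one s avoiding also the roots of x_k - x_0 makes this
    an identity of rational functions, which can be differentiated at s = 0. *)

Require Import Defs.
From mathcomp Require Import all_boot all_order all_algebra.
From mathcomp Require Import complex.
From mathcomp Require Import reals.
From mathcomp Require Import boolp classical_sets cardinality ereal.
From mathcomp Require Import measure lebesgue_measure.
From mathcomp Require Import ring.

Set Implicit Arguments.
Unset Strict Implicit.
Unset Printing Implicit Defensive.

Import Order.TTheory GRing.Theory Num.Theory.
Local Open Scope ring_scope.

Lemma not_countable_realType (R : realType) : ~ countable [set: R].
Proof.
move=> /(@sub_countable _ _ `[0, 1]%classic _ (subset_card_le (@subsetT _ _))).
move=> /countable_lebesgue_measure0.
by rewrite lebesgue_measure_itv /= lte_fin ltr01 oppr0 adde0 => /eqP;
  rewrite eqe oner_eq0.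
Qed.

(** Each polynomial has finitely many roots, so only countably many real parameters are excluded. *)
Lemma ex_common_nonroot (R : realType) (E : nat -> {poly R[i]}) :
  (forall n, E n != 0) -> exists s, forall n, (E n).[s] != 0.
Proof.
move=> E_neq0; apply: contrapT => noE.
apply: (@not_countable_realType R).
pose Z n := [set x : R | (E n).[real_complex R x] = 0]%classic.
have Zcount n : countable (Z n).
  apply: finite_set_countable.
  have [r rE] := closed_field_poly_normal (E n).
  apply: (@sub_finite_set _ _ [set` map (@complex.Re R) r]%classic);
    last exact: finite_seq.
  move=> x /= /eqP Enx; apply/mapP; exists (real_complex R x) => //.
  move: Enx; rewrite rE -/(root _ _) rootZ ?lead_coef_eq0 //.
  by rewrite root_prod_XsubC.
apply: (@sub_countable _ _ _ (\bigcup_n Z n)%classic); last first.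
  by apply: bigcup_countable => // n _; exact: Zcount.
apply: subset_card_le => x _; apply: contrapT => xZ.
apply: noE; exists (real_complex R x) => n; apply/eqP => Enx.
by apply: xZ; exists n.
Qed.

Section Jets.
Variables (F : fieldType) (b : F).
Implicit Types (c d s : F) (p q : {poly F} * {poly F}).

Definition ratio p s := p.1.[s] / p.2.[s].

(* [p] encodes the rational function p.1 / p.2, which at 0 is regular with value
   [c] and derivative [d]. *)
Definition has_jet p c d :=
  [/\ p.2.[0] != 0, p.1.[0] = c * p.2.[0]
    & p.1^`().[0] = d * p.2.[0] + c * p.2^`().[0]].

(** Nothing is cancelled: the denominator keeps the factors [p.2] and [w], so where it is nonzero
    the recurrence step is defined. *)
Definition gm_next p q : {poly F} * {poly F} :=
  let w := b *: q.2 ^+ 2 + q.1 ^+ 2 in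
  (q.1 * q.2 * p.2 - p.1 * w, p.2 * w).

Definition gm_orbit p q n :=
  (iter n (fun pq => (pq.2, gm_next pq.1 pq.2)) (p, q)).1.

Lemma gm_orbitSS p q n :
  gm_orbit p q n.+2 = gm_next (gm_orbit p q n) (gm_orbit p q n.+1).
Proof. by []. Qed.

(** The coefficient of [d'] is the derivative of y / (b + y^2) at [c']. *)
Lemma has_jet_next p q c d c' d' :
    b + c' ^+ 2 != 0 -> has_jet p c d -> has_jet q c' d' ->
  has_jet (gm_next p q) (- c + c' / (b + c' ^+ 2))
    (- d + (b - c' ^+ 2) / (b + c' ^+ 2) ^+ 2 * d').
Proof.
case: p q => [p1 p2] [q1 q2] bc [/= p2N0 p1E p1'E] [/= q2N0 q1E q1'E].
rewrite /has_jet /gm_next /= !(derivE, hornerE) /= p1E p1'E q1E q1'E; split.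
- rewrite [X in _ * X](_ : _ = (b + c' ^+ 2) * q2.[0] ^+ 2); last by ring.
  by rewrite !mulf_neq0 ?expf_neq0.
- by field.
- by field.
Qed.

(** Differentiate the cross-multiplied identity at 0 and cancel the nonzero denominators. *)
Lemma has_jet_inj p q c d d' : p.1 * q.2 = q.1 * p.2 ->
  has_jet p c d -> has_jet q c d' -> d = d'.
Proof.
case: p q => [p1 p2] [q1 q2] /= pq [/= p2N0 p1E p1'E] [/= q2N0 q1E q1'E].
have /(congr1 (fun r : {poly F} => r^`().[0])) := pq.
rewrite !(derivE, hornerE) /= p1E p1'E q1E q1'E => H.
apply: (mulIf (mulf_neq0 p2N0 q2N0)).
apply: (addIr (c * (p2^`().[0] * q2.[0] + p2.[0] * q2^`().[0]))).
by transitivity ((d * p2.[0] + c * p2^`().[0]) * q2.[0] +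
  c * p2.[0] * q2^`().[0]); [ring | rewrite H; ring].
Qed.

Lemma ratio_next p q s : p.2.[s] != 0 -> q.2.[s] != 0 ->
    (gm_next p q).2.[s] != 0 ->
  b + ratio q s ^+ 2 != 0 /\
  ratio (gm_next p q) s =
    - ratio p s + ratio q s / (b + ratio q s ^+ 2).
Proof.
case: p q => [p1 p2] [q1 q2]; rewrite /ratio /gm_next /= !hornerE /=.
move=> p2N0 q2N0; rewrite mulf_eq0 negb_or p2N0 /= => wN0.
have E : b + (q1.[s] / q2.[s]) ^+ 2 =
  (b * q2.[s] * q2.[s] + q1.[s] ^+ 2) / q2.[s] ^+ 2 by field.
split; first by rewrite E mulf_neq0 ?invr_neq0 ?expf_neq0.
by rewrite E; field; rewrite ?p2N0 ?q2N0 ?wN0.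
Qed.

End Jets.

Lemma gumovski_miraP (R : realType) (b x y z : R[i]) :
  gumovski_mira b x y = Some z <->
  b + y ^+ 2 != 0 /\ z = - x + y / (b + y ^+ 2).
Proof.
rewrite /gumovski_mira; case: eqP => _; first by split=> // -[].
by split=> [[->]|[_ ->]].
Qed.

Section Linearization.
Variables (R : realType) (b : R[i]) (k : nat).
Hypothesis gm_per : all_periodic (gumovski_mira b) k.

Lemma linearized_periodic (c d : nat -> R[i]) :
    solution (gumovski_mira b) c ->
    (forall n, d n.+2 =
       - d n + (b - c n.+1 ^+ 2) / (b + c n.+1 ^+ 2) ^+ 2 * d n.+1) ->
  d k = d 0%N.
Proof.
move=> c_sol dSS; have cP n := (gumovski_miraP _ _ _ _).1 (c_sol n).
(* For n = 0, 1: the line of initial conditions through [(c 0, c 1)] with direction [(d 0, d 1)]. *)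
pose start n : {poly R[i]} * {poly R[i]} := ((c n)%:P + d n *: 'X, 1).
pose P := gm_orbit b (start 0%N) (start 1%N).
have jet_start n : has_jet (start n) (c n) (d n).
  by rewrite /has_jet /start /= !(derivE, hornerE) oner_eq0.
have jetP n : has_jet (P n) (c n) (d n).
  suff [] : has_jet (P n) (c n) (d n) /\ has_jet (P n.+1) (c n.+1) (d n.+1).
    by [].
  elim: n => [|n [IH0 IH1]]; first by split; apply: jet_start.
  split=> //; have [bN0 ->] := cP n.
  by rewrite dSS /P gm_orbitSS; apply: has_jet_next.
have P2N0 n : (P n).2 != 0.
  by have [+ _ _] := jetP n; apply: contra_neq => ->; rewrite horner0.
pose G := (P k).1 * (P 0%N).2 - (P 0%N).1 * (P k).2.
have [/eqP|GN0] := eqVneq G 0.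
  rewrite subr_eq0 => /eqP /has_jet_inj; apply; first exact: jetP.
  by have := gm_per c_sol 0%N; rewrite add0n => ->; exact: jetP.
(* [G] is the numerator of x_k - x_0; a common nonroot gives a well-defined solution with x_k
   different from x_0. *)
pose E n := if n is m.+1 then (P m).2 else G.
have [|s sE] := @ex_common_nonroot R E; first by case.
have sP n : (P n).2.[s] != 0 by exact: (sE n.+1).
have : solution (gumovski_mira b) (fun n => ratio (P n) s).
  move=> n; apply/gumovski_miraP.
  by apply: ratio_next; [exact: sP | exact: sP | exact: (sP n.+2)].
move=> /gm_per /(_ 0%N); rewrite add0n /ratio => /eqP.
rewrite eqr_div ?sP // => /eqP PkE.
by case/eqP: (sE 0%N); rewrite hornerD hornerN !hornerM PkE subrr.
Qed.

(** For a root [l] of X^2 - t X + 1, the powers [l ^+ n] solve the linearized recurrence, so period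
    [k] gives [l ^+ k = 1]. *)
Lemma trace_root_of_unity (c : nat -> R[i]) (t : R[i]) :
    solution (gumovski_mira b) c ->
    (forall n, (b - c n ^+ 2) / (b + c n ^+ 2) ^+ 2 = t) ->
  exists2 l : R[i], l ^+ k = 1 & t = l + l^-1.
Proof.
move=> c_sol c_t; pose l : R[i] := (t + sqrtC (t ^+ 2 - 4)) / 2.
have lE : l ^+ 2 = t * l - 1.
  have sq := sqrtCK (t ^+ 2 - 4).
  have -> : l ^+ 2 = (t ^+ 2 + 2 * t * sqrtC (t ^+ 2 - 4) +
    sqrtC (t ^+ 2 - 4) ^+ 2) / 4 by rewrite /l; field.
  by rewrite sq /l; field.
have lN0 : l != 0.
  apply/eqP => l0; move: lE; rewrite l0 expr0n mulr0 sub0r => /eqP.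
  by rewrite eq_sym oppr_eq0 oner_eq0.
exists l; last by apply: (mulIf lN0); rewrite mulrDl mulVf // -expr2 lE; ring.
rewrite -(expr0 l); apply: (linearized_periodic (d := fun n => l ^+ n) c_sol).
move=> n; rewrite c_t.
have -> : l ^+ n.+2 = l ^+ n * l ^+ 2 by rewrite -exprD addn2.
by rewrite lE exprS; ring.
Qed.

End Linearization.

(** On the unit circle z + 1/z = 2 Re z lies in [-2, 2], so two values differing by 4 are the
    endpoints. *)
Lemma unit_circle_gap (C : numClosedFieldType) (l m : C) :
    `|l| = 1 -> `|m| = 1 -> m + m^-1 = l + l^-1 + 4 -> l + l^-1 = - 2.
Proof.
have ReE1 (z : C) : `|z| = 1 -> z + z^-1 = 'Re z * 2.
  by move=> z1; rewrite invC_norm z1 expr1n invr1 mul1r ReE divfK ?pnatr_eq0.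
move=> l1 m1; rewrite !ReE1 // => E.
have Rem : 'Re m = 'Re l + 2.
  by apply: (@mulIf _ 2); rewrite ?pnatr_eq0 // E; ring.
have Rem1 : 'Re m <= 1 by rewrite -m1; apply: leif_Re_Creal.
have Rel1 : - 1 <= 'Re l.
  by rewrite lerNl -raddfN -l1 -normrN; apply: leif_Re_Creal.
have /eqP -> : 'Re l == - 1; last by ring.
rewrite eq_le Rel1 andbT -(lerD2r 2) -Rem.
by have -> : - 1 + 2 = 1 :> C by ring.
Qed.

Lemma gm0_not_periodic (R : realType) (k : nat) : (0 < k)%N ->
  ~ all_periodic (gumovski_mira (0 : R[i])) k.
Proof.
move=> k0 per; have N20 : (- 2 : R[i]) != 0 by rewrite oppr_eq0 pnatr_eq0.
pose x n : R[i] := if odd n then - (- 2) ^- n./2 else (- 2) ^+ n./2.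
have x_sol : solution (gumovski_mira 0) x.
  move=> n; apply/gumovski_miraP; rewrite /x /= negbK uphalf_half.
  have XN0 : (- 2 : R[i]) ^+ n./2 != 0 by rewrite expf_neq0.
  rewrite add0r; case: (odd n) => /=.
    rewrite add1n !(exprS _ n./2); split.
      by rewrite expf_neq0 // mulf_neq0.
    by field; rewrite XN0.
  rewrite add0n sqrrN (exprS _ n./2); split.
    by rewrite expf_neq0 // invr_neq0.
  by field; rewrite XN0.
have xD := per _ x_sol.
(* The index [k + k] is even whatever the parity of [k], so the term there is (-2)^k, of norm 2^k >
   1. *)
have : x (k + k)%N = x 0%N by rewrite xD -(xD 0%N) add0n.
rewrite /x addnn odd_double doubleK /= => /(congr1 Num.norm).
rewrite normrX normrN normr_nat normr1 => /eqP.
by rewrite pexpr_eq1 // ?ler0n // pnatr_eq1.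
Qed.

Theorem proposition6 (R : realType) (b : R[i]) :
  ~ globally_periodic (gumovski_mira b).
Proof.
case=> k [k0 per _].
have n2 : (2 : R[i]) != 0 by rewrite pnatr_eq0.
(* Where b + y^2 is 1/2 or -1/2, the term y / (b + y^2) is 2y or -2y. *)
pose c : R[i] := sqrtC (2^-1 - b); pose e : R[i] := sqrtC (- 2^-1 - b).
have c2 : b + c ^+ 2 = 2^-1 by rewrite sqrtCK; ring.
have e2 : b + e ^+ 2 = - 2^-1 by rewrite sqrtCK; ring.
have c_sol : solution (gumovski_mira b) (fun=> c).
  by move=> n; apply/gumovski_miraP; rewrite c2 invr_neq0 //; split=> //; field.
have e_sol : solution (gumovski_mira b) (fun n => (-1) ^+ n * e).
  move=> n; apply/gumovski_miraP; rewrite exprMn sqrr_sign mul1r e2.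
  by rewrite oppr_eq0 invr_neq0 //; split=> //; rewrite !exprS; field.
have [|l lk lE] := @trace_root_of_unity _ _ _ per _ (8 * b - 2) c_sol.
  by move=> n; rewrite c2 sqrtCK; field.
have [|m mk mE] := @trace_root_of_unity _ _ _ per _ (8 * b + 2) e_sol.
  by move=> n; rewrite exprMn sqrr_sign mul1r e2 sqrtCK; field.
have norm1 (z : R[i]) : z ^+ k = 1 -> `|z| = 1.
  by move=> /(congr1 Num.norm) /eqP; rewrite normrX normr1 pexpr_eq1 // => /eqP.
(* The traces 8b - 2 and 8b + 2 differ by 4, so the smaller is -2. *)
have := unit_circle_gap (norm1 _ lk) (norm1 _ mk).
rewrite -lE -mE => /(_ _)/eqP; rewrite -subr_eq0 opprK subrK mulf_eq0 pnatr_eq0.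
move=> /= b0; apply: (@gm0_not_periodic R k k0); rewrite -(eqP (b0 _)) //.
by ring.
Qed.
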